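(* Let $m\le n$. Up to range equivalence, the set of orthogonal multiplications $F:\mathbb{R}^m\times\mathbb{R}^n\to\mathbb{R}^{p}$, $n\le p\le mn$ (all regarded as maps into $\mathbb{R}^{mn}$), is identified, via $F\mapsto c$ with $c_{ij,kl}=F_{ij,kl}-\delta_{ik}\delta_{jl}$, with the set $\mathcal{C}\subset W^\perp\simeq\wedge^2\mathbb{R}^m\otimes\wedge^2\mathbb{R}^n$ of all $c\in W^\perp$ for which the symmetric endomorphism $\iota+c$ of $\mathbb{R}^m\otimes\mathbb{R}^n$ is positive semidefinite. The set $\mathcal{C}$ is compact and convex, its interior consists of the orthogonal multiplications that are full in $\mathbb{R}^{mn}$, and the non-full ones lie on its boundary. Moreover $\mathcal{C}$ is invariant under the action of $SO(m)\otimes SO(n)$, and the moduli space of orthogonal multiplications of type $[m,n,p]$, with $m\le n$ fixed and $n\le p\le mn$ varying, up to domain and range equivalence, is $\mathcal{C}/SO(m)\otimes SO(n)$.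
   Context: An orthogonal multiplication of type $[m,n,p]$ is a bilinear map $F:\mathbb{R}^m\times\mathbb{R}^n\to\mathbb{R}^p$ with $|F(x,y)|=|x||y|$ for all $x,y$. It is full if its image spans $\mathbb{R}^p$. Range equivalence is equivalence up to orthogonal transformations of the range; domain equivalence is equivalence up to the action of $SO(m)\times SO(n)$ on $\mathbb{R}^m\times\mathbb{R}^n$. Let $e_1,\dots,e_m$ and $f_1,\dots,f_n$ be orthonormal bases of $\mathbb{R}^m$ and $\mathbb{R}^n$, and set $F_{ij,kl}=\langle F(e_i,f_j),F(e_k,f_l)\rangle$. Elements $\sum c_{ij,kl}(e_i\otimes f_j)\odot(e_k\otimes f_l)$ of $S^2(\mathbb{R}^m\otimes\mathbb{R}^n)$ (with $c_{ij,kl}=c_{kl,ij}$) are regarded as symmetric endomorphisms $e_i\otimes f_j\mapsto\sum_{kl}c_{ij,kl}\,e_k\otimes f_l$ of $\mathbb{R}^m\otimes\mathbb{R}^n\simeq\mathbb{R}^{mn}$, and $\iota=\sum_{ij}(e_i\otimes f_j)\odot(e_i\otimes f_j)$ corresponds to the identity. Let $W=\mathrm{span}\{(a\otimes b)\odot(a\otimes b)\}\subset S^2(\mathbb{R}^m\otimes\mathbb{R}^n)$ and let $W^\perp$ be its orthogonal complement. Equivalently, $W^\perp$ consists of the $c$ with $c_{ij,kl}=[ik,jl]$, where $[ik,jl]$ is skew-symmetric in $i,k$ and skew-symmetric in $j,l$, so that $W^\perp\simeq\wedge^2\mathbb{R}^m\otimes\wedge^2\mathbb{R}^n$. *)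

(* Defs.v *)
From HB Require Import structures.
From mathcomp Require Import all_boot all_order all_algebra.
From mathcomp Require Import mxtens.
From mathcomp Require Import all_classical all_reals all_analysis.
Import Order.TTheory GRing.Theory Num.Theory.
Import numFieldNormedType.Exports.

Set Implicit Arguments.
Unset Strict Implicit.
Unset Printing Implicit Defensive.

Local Open Scope classical_set_scope.
Local Open Scope ring_scope.

Definition dot (R : realType) (p : nat) (u v : 'rV[R]_p) : R :=
  \sum_(i < p) u 0 i * v 0 i.

(* The Euclidean norm; the library norm `|u| on 'rV[R]_p is the sup norm. *)
Definition enorm (R : realType) (p : nat) (u : 'rV[R]_p) : R :=
  Num.sqrt (dot u u).

Definition orthonormal_basis (R : realType) (p : nat)
    (e : 'I_p -> 'rV[R]_p) : Prop :=
  forall i j, dot (e i) (e j) = (i == j)%:R.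

(* Linear span of an arbitrary, possibly infinite, set of vectors. *)
Definition lin_span (R : realType) (V : lmodType R) (S : set V) : set V :=
  [set x | exists (k : nat) (a : 'I_k -> R) (v : 'I_k -> V),
     (forall i, S (v i)) /\ x = \sum_(i < k) a i *: v i].

Definition orthogonal_group (R : realType) (p : nat) : set 'M[R]_p :=
  [set A | A *m A^T = 1%:M].

Definition special_orthogonal_group (R : realType) (p : nat) : set 'M[R]_p :=
  [set A | orthogonal_group A /\ \det A = 1].

Definition is_orthogonal_multiplication (R : realType) (m n p : nat)
    (F : 'rV[R]_m -> 'rV[R]_n -> 'rV[R]_p) : Prop :=
  bilinear_for *:%R *:%R F /\
  forall x y, enorm (F x y) = enorm x * enorm y.

(* Orthogonal multiplications of type [m, n, p] with m, n fixed and p varying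
   between n and m * n. *)
Record orthmult (R : realType) (m n : nat) := OrthMult {
  om_dim : nat;
  om_map : 'rV[R]_m -> 'rV[R]_n -> 'rV[R]_om_dim;
  om_dim_ge : (n <= om_dim)%N;
  om_dim_le : (om_dim <= m * n)%N;
  om_axiom : is_orthogonal_multiplication om_map }.

(* F regarded as a map into R^(mn): composition with the inclusion
   (v_1, ..., v_p) |-> (v_1, ..., v_p, 0, ..., 0). *)
Definition om_ext (R : realType) (m n : nat) (F : orthmult R m n)
    (x : 'rV[R]_m) (y : 'rV[R]_n) : 'rV[R]_(m * n) :=
  om_map F x y *m pid_mx (om_dim F).

Definition full_in_mn (R : realType) (m n : nat) (F : orthmult R m n) : Prop :=
  lin_span [set z | exists x y, z = om_ext F x y] = setT.

Definition range_equiv (R : realType) (m n : nat) (F G : orthmult R m n) :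
    Prop :=
  exists2 U : 'M[R]_(m * n), orthogonal_group U &
    forall x y, om_ext G x y = om_ext F x y *m U.

Definition domain_range_equiv (R : realType) (m n : nat)
    (F G : orthmult R m n) : Prop :=
  exists (A : 'M[R]_m) (B : 'M[R]_n) (U : 'M[R]_(m * n)),
    [/\ special_orthogonal_group A, special_orthogonal_group B,
        orthogonal_group U &
        forall x y, om_ext G x y = om_ext F (x *m A) (y *m B) *m U].

(* The set of classes, in A, of an equivalence relation E. *)
Definition quotient_set (T : Type) (A : set T) (E : T -> T -> Prop) :
    set (set T) :=
  [set [set y | A y /\ E x y] | x in A].

(* R^m (x) R^n is 'rV[R]_(m * n), with the tensor product of row vectors given
   by the Kronecker product. *)
Definition tensv (R : realType) (m n : nat) (a : 'rV[R]_m) (b : 'rV[R]_n) :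
    'rV[R]_(m * n) := tensmx a b.

(* S^2(V), V = 'rV[R]_N, consists of the symmetric matrices, acting on V by
   w |-> w *m c. With this normalization
   \sum_(i, j) c_ij (v_i (.) v_j), for c symmetric and v orthonormal, is the
   endomorphism v_i |-> \sum_j c_ij v_j. *)
Definition symprod (R : realType) (N : nat) (u v : 'rV[R]_N) : 'M[R]_N :=
  2^-1 *: (u^T *m v + v^T *m u).

Definition symmx (R : realType) (N : nat) : set 'M[R]_N := [set c | c^T = c].

Definition Wspace (R : realType) (m n : nat) : set 'M[R]_(m * n) :=
  lin_span [set w | exists (a : 'rV[R]_m) (b : 'rV[R]_n),
    w = symprod (tensv a b) (tensv a b)].

(* The orthogonal complement is taken inside S^2, for the inner product
   <c, d> = tr (c d^T). *)
Definition Wperp (R : realType) (m n : nat) : set 'M[R]_(m * n) :=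
  [set c | symmx c /\ forall w, Wspace w -> \tr (c *m w^T) = 0].

Definition quad_tensor (R : realType) (m n : nat)
    (e : 'I_m -> 'rV[R]_m) (f : 'I_n -> 'rV[R]_n)
    (c : 'I_m -> 'I_n -> 'I_m -> 'I_n -> R) : 'M[R]_(m * n) :=
  \sum_(i < m) \sum_(j < n) \sum_(k < m) \sum_(l < n)
    c i j k l *: symprod (tensv (e i) (f j)) (tensv (e k) (f l)).

(* wedge^2 R^m (x) wedge^2 R^n, as the arrays b i k j l = [ik,jl] that are
   skew-symmetric in i, k and in j, l. *)
Definition wedge2_tensor_wedge2 (R : realType) (m n : nat) :
    set ('I_m -> 'I_m -> 'I_n -> 'I_n -> R) :=
  [set b | (forall i k j l, b i k j l = - b k i j l) /\
           (forall i k j l, b i k j l = - b i k l j)].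

Definition om_tensor (R : realType) (m n : nat)
    (e : 'I_m -> 'rV[R]_m) (f : 'I_n -> 'rV[R]_n) (F : orthmult R m n) :
    'M[R]_(m * n) :=
  quad_tensor e f (fun i j k l =>
    dot (om_map F (e i) (f j)) (om_map F (e k) (f l))
    - (i == k)%:R * (j == l)%:R).

Definition positive_semidefinite (R : realType) (N : nat) (c : 'M[R]_N) :
    Prop :=
  symmx c /\ forall w : 'rV[R]_N, 0 <= dot (w *m c) w.

(* The identity 1%:M is the endomorphism of
   iota = \sum_(i, j) (e_i (x) f_j) (.) (e_i (x) f_j). *)
Definition moduli_body (R : realType) (m n : nat) : set 'M[R]_(m * n) :=
  [set c | Wperp c /\ positive_semidefinite (1%:M + c)].

(* Interior and boundary in the subspace topology of A. *)
Definition interior_in (T : topologicalType) (A B : set T) : set T :=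
  interior (B : set (subspace A)).

Definition boundary_in (T : topologicalType) (A B : set T) : set T :=
  closure (B : set (subspace A)) `\` interior_in A B.

Definition SO_tensor_SO (R : realType) (m n : nat) : set 'M[R]_(m * n) :=
  [set g | exists (A : 'M[R]_m) (B : 'M[R]_n),
     [/\ special_orthogonal_group A, special_orthogonal_group B &
         g = tensmx A B]].

(* The action on S^2 induced by v |-> g v; on symmetric endomorphisms it is
   conjugation, as g^T = g^-1. *)
Definition sym_act (R : realType) (N : nat) (g c : 'M[R]_N) : 'M[R]_N :=
  g *m c *m g^T.

Definition SO_orbit_rel (R : realType) (m n : nat) (c d : 'M[R]_(m * n)) :
    Prop :=
  exists2 g, @SO_tensor_SO R m n g & d = sym_act g c.

(* Main.v *)
Require Import Defs.
From HB Require Import structures.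
From mathcomp Require Import all_boot all_order all_algebra.
From mathcomp Require Import mxtens ring lra.
From mathcomp Require Import all_classical all_reals all_analysis.
Import Order.TTheory GRing.Theory Num.Theory.
Import numFieldNormedType.Exports.

Set Implicit Arguments.
Unset Strict Implicit.
Unset Printing Implicit Defensive.

Local Open Scope classical_set_scope.
Local Open Scope ring_scope.

(** Write [F x y = tensv x y *m S], which is possible for any bilinear [F]
    with values in [R^(mn)].  The inner products of the values of [F] are the
    entries of the Gram matrix [S *m S^T] in the basis of the [e_i (x) f_j], so
    [om_tensor e f F] is the matrix [c = S *m S^T - 1], whatever the
    orthonormal bases are ([om_tensorE]).  The condition
    [|F(x, y)| = |x| |y|] says that the quadratic form of [c] vanishes on all
    pure tensors, that is, [c] lies in [Wperp] ([moduli_body_gram]), while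
    [1 + c] is positive semidefinite because it is a Gram matrix.  Two facts of
    linear algebra turn this into a classification:

    - a positive semidefinite matrix is a Gram matrix ([psd_factor], by
      Cholesky elimination), so that every point of the body comes from some
      [F], with values in [R^(mn)] itself;
    - two matrices with the same Gram matrix differ by an orthogonal
      transformation on the right ([gram_eq_orthogonal], by successive
      reflections), so that [c] determines [F] up to range equivalence.

    Precomposing [F] with [(A, B)] replaces [S] by [tensmx A B *m S], hence [c]
    by its image under the action of [tensmx A B]; this gives the moduli space
    up to domain equivalence as well.  Both quotients are instances of
    [quotient_set_bij].

    [F] is full when [S] is invertible, that is, when [1 + c] is.  If it is,
    the form of [1 + c] is coercive and stays nonnegative under small symmetric
    perturbations; if not, a nonzero null vector [w] of [1 + c] makes the form of
    [1 + (1 + t) c] negative at [w] for every [t > 0].  Hence the full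
    multiplications form the interior ([moduli_body_interior]).  The body is
    closed, and it is bounded because [c] has a zero diagonal, which together
    with positivity keeps its entries between -1 and 1. *)

(** * Inner products and quadratic forms *)

Section Dot.
Variables (R : realType) (N : nat).
Implicit Types u v w : 'rV[R]_N.

Lemma dotE u v : dot u v = (u *m v^T) 0 0.
Proof. by rewrite mxE; apply: eq_bigr => i _; rewrite mxE. Qed.

Lemma dotC u v : dot u v = dot v u.
Proof. by apply: eq_bigr => i _; rewrite mulrC. Qed.

Lemma dotDl u v w : dot (u + v) w = dot u w + dot v w.
Proof. by rewrite !dotE mulmxDl mxE. Qed.

Lemma dotZl a u w : dot (a *: u) w = a * dot u w.
Proof. by rewrite !dotE -scalemxAl mxE. Qed.

Lemma dotNl u w : dot (- u) w = - dot u w.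
Proof. by rewrite !dotE mulNmx mxE. Qed.

Lemma dotDr u v w : dot w (u + v) = dot w u + dot w v.
Proof. by rewrite dotC dotDl !(dotC w). Qed.

Lemma dotZr a u w : dot w (a *: u) = a * dot w u.
Proof. by rewrite dotC dotZl (dotC w). Qed.

Lemma dotNr u w : dot w (- u) = - dot w u.
Proof. by rewrite dotC dotNl (dotC w). Qed.

Lemma dot0l w : dot 0 w = 0.
Proof. by rewrite dotE mul0mx mxE. Qed.

Lemma dot_suml (I : Type) (r : seq I) (F : I -> 'rV[R]_N) w :
  dot (\sum_(i <- r) F i) w = \sum_(i <- r) dot (F i) w.
Proof.
elim: r => [|i r IH]; first by rewrite !big_nil dot0l.
by rewrite !big_cons dotDl IH.
Qed.

Lemma dot_ge0 u : 0 <= dot u u.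
Proof. by apply: sumr_ge0 => i _; rewrite -expr2 sqr_ge0. Qed.

Lemma dot_eq0 u : dot u u = 0 -> u = 0.
Proof.
move=> /eqP; rewrite psumr_eq0 => [/allP h|i _]; last by rewrite -expr2 sqr_ge0.
apply/rowP => i; have := h i; rewrite mem_index_enum => /(_ isT) /=.
by rewrite mulf_eq0 orbb mxE => /eqP.
Qed.

Lemma dot_gt0 u : u != 0 -> 0 < dot u u.
Proof.
move=> u0; rewrite lt_def dot_ge0 andbT.
by apply: contraNneq u0 => /dot_eq0 ->.
Qed.

Lemma dot_delta u j : dot u (delta_mx 0 j) = u 0 j.
Proof. by rewrite dotE trmx_delta -colE mxE. Qed.

Lemma dot_deltamx (c : 'M[R]_N) i j :
  dot (delta_mx 0 i *m c) (delta_mx 0 j) = c i j.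
Proof. by rewrite dot_delta -rowE mxE. Qed.

Lemma sqr_le_dot u i : u 0 i ^+ 2 <= dot u u.
Proof.
rewrite /dot (bigD1 i) //= -expr2 lerDl.
by apply: sumr_ge0 => j _; rewrite -expr2 sqr_ge0.
Qed.

Lemma normM_le_dot u i j : `|u 0 i| * `|u 0 j| <= dot u u.
Proof.
have hi := sqr_le_dot u i; have hj := sqr_le_dot u j.
rewrite -normrM ler_norml.
have := sqr_ge0 (u 0 i - u 0 j); have := sqr_ge0 (u 0 i + u 0 j).
by move=> h1 h2; apply/andP; split; nra.
Qed.

Lemma quad_formE (c : 'M[R]_N) u v :
  dot (u *m c) v = \sum_i \sum_j u 0 i * c i j * v 0 j.
Proof.
rewrite /dot exchange_big /=; apply: eq_bigr => j _.
by rewrite mxE mulr_suml.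
Qed.

(** The crude constant [N ^ 2 * b] comes from bounding each product
    [|u_i| * |u_j|] by [dot u u]; any constant that depends only on [N] and [b]
    would do below. *)
Lemma quad_form_bound (c : 'M[R]_N) b w : (forall i j, `|c i j| <= b) ->
  `|dot (w *m c) w| <= N%:R ^+ 2 * b * dot w w.
Proof.
move=> cb; rewrite quad_formE.
have -> : N%:R ^+ 2 * b * dot w w = \sum_(i < N) \sum_(j < N) b * dot w w.
  by rewrite !sumr_const card_ord -mulrnA -[RHS]mulr_natl natrM expr2 !mulrA.
apply: le_trans (ler_norm_sum _ _ _) _; apply: ler_sum => i _.
apply: le_trans (ler_norm_sum _ _ _) _; apply: ler_sum => j _.
rewrite !normrM mulrAC mulrC; apply: ler_pM => //.
exact: normM_le_dot.
Qed.

End Dot.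

Lemma dot_mulmx (R : realType) p q (u : 'rV[R]_p) (c : 'M[R]_(p, q)) v :
  dot (u *m c) v = dot u (v *m c^T).
Proof. by rewrite !dotE trmx_mul trmxK mulmxA. Qed.

Lemma dot_gram (R : realType) p q (S : 'M[R]_(p, q)) (u v : 'rV[R]_p) :
  dot (u *m (S *m S^T)) v = dot (u *m S) (v *m S).
Proof. by rewrite mulmxA [LHS]dot_mulmx trmxK. Qed.

Lemma gramE (R : realType) p q (S : 'M[R]_(p, q)) i j :
  (S *m S^T) i j = dot (row i S) (row j S).
Proof. by rewrite mxE; apply: eq_bigr => k _; rewrite !mxE. Qed.

(** * Gram matrices and orthogonal transformations *)

Lemma orthogonal_group1 (R : realType) N : orthogonal_group (1%:M : 'M[R]_N).
Proof. by rewrite /orthogonal_group /= trmx1 mulmx1. Qed.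

Lemma orthogonal_groupM (R : realType) N (A B : 'M[R]_N) :
  orthogonal_group A -> orthogonal_group B -> orthogonal_group (A *m B).
Proof.
rewrite /orthogonal_group /= => hA hB.
by rewrite trmx_mul mulmxA -(mulmxA A) hB mulmx1.
Qed.

Lemma orthogonal_groupT (R : realType) N (A : 'M[R]_N) :
  orthogonal_group A -> orthogonal_group A^T.
Proof. by rewrite /orthogonal_group /= trmxK => /mulmx1C. Qed.

(** The reflection in the hyperplane orthogonal to [a - b] exchanges [a] and
    [b] when they have the same length, and it fixes every vector that has the
    same inner product with both. *)
Lemma reflection_exists (R : realType) N (a b : 'rV[R]_N) :
  dot a a = dot b b ->
  exists U : 'M[R]_N, [/\ orthogonal_group U, a *m U = b &
    forall v, dot v a = dot v b -> v *m U = v].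
Proof.
move=> ab; have [<-|neq] := eqVneq a b.
  exists 1%:M; split => [||v _]; rewrite ?mulmx1 //.
  exact: orthogonal_group1.
pose d := a - b; have d0 : dot d d != 0.
  by rewrite gt_eqF // dot_gt0 // subr_eq0.
pose U : 'M[R]_N := 1%:M - (2 / dot d d) *: (d^T *m d).
have UE v : v *m U = v - (2 * dot v d / dot d d) *: d.
  rewrite mulmxBr mulmx1 -scalemxAr mulmxA [v *m d^T]mx11_scalar -dotE.
  by rewrite mul_scalar_mx scalerA mulrAC.
exists U; split.
- have PP : (d^T *m d) *m (d^T *m d) = dot d d *: (d^T *m d).
    rewrite mulmxA -(mulmxA d^T) [d *m d^T]mx11_scalar -dotE.
    by rewrite mul_mx_scalar -scalemxAl.
  have UT : U^T = U.
    by rewrite /U linearB linearZ /= trmx1 trmx_mul trmxK.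
  rewrite /orthogonal_group /= UT /U; move: PP; move: (d^T *m d) => P PP.
  rewrite mulmxBl mul1mx mulmxBr mulmx1 -scalemxAl -scalemxAr PP !scalerA.
  rewrite -addrA -opprD -[RHS]subr0; congr (_ - _).
  rewrite -scalerBl -scalerDl.
  by rewrite -[RHS](scale0r P); congr (_ *: _); field.
- rewrite UE; have -> : 2 * dot a d = dot d d.
    by rewrite /d !(dotDl, dotDr, dotNl, dotNr) -ab (dotC b a); ring.
  by rewrite divff // scale1r /d opprB addrC subrK.
- move=> v va; rewrite UE /d dotDr dotNr va subrr mulr0 mul0r scale0r.
  by rewrite subr0.
Qed.

(** The orthogonal transformation is built row by row, as in the proof of
    the Witt extension theorem: once it carries the first [k] rows of [A] to
    those of [B], a reflection moves the image of the next row to its place.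
    Equality of the Gram matrices makes the rows already placed have the same
    inner product with both, so that the reflection leaves them alone. *)
Lemma gram_eq_orthogonal (R : realType) p N (A B : 'M[R]_(p, N)) :
  A *m A^T = B *m B^T -> exists2 U, orthogonal_group U & B = A *m U.
Proof.
move=> AB.
have rowE2 i j : dot (row i A) (row j A) = dot (row i B) (row j B).
  by rewrite -!gramE AB.
suff /(_ p (leqnn p)) [U [hU UE]] : forall k, (k <= p)%N ->
    exists U, orthogonal_group U /\
      forall i : 'I_p, (i < k)%N -> row i A *m U = row i B.
  by exists U => //; apply/row_matrixP => i; rewrite row_mul UE.
elim=> [_|k IH kp].
  by exists 1%:M; split => //; exact: orthogonal_group1.
have [U [hU UE]] := IH (ltnW kp); pose k0 := Ordinal kp.
have [|V [hV Vk Vfix]] := @reflection_exists R N (row k0 A *m U) (row k0 B).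
  by rewrite dot_mulmx -mulmxA hU mulmx1.
exists (U *m V); split; first exact: orthogonal_groupM.
move=> i; rewrite ltnS leq_eqVlt mulmxA => /predU1P[ik|ik].
  by have -> : i = k0 by exact/val_inj.
rewrite UE // Vfix // -[in LHS]UE // dot_mulmx -mulmxA hU mulmx1.
exact: rowE2.
Qed.

(** * Positive semidefinite matrices are Gram matrices *)

Lemma dot_row_mx (R : realType) p q (u u' : 'rV[R]_p) (v v' : 'rV[R]_q) :
  dot (row_mx u v) (row_mx u' v') = dot u u' + dot v v'.
Proof. by rewrite !dotE tr_row_mx mul_row_col mxE. Qed.

(** A nonnegative quadratic form that vanishes on the first coordinate line
    has no mixed terms with that coordinate: otherwise moving along the line
    would change the form linearly, without bound. *)
Lemma psd_corner0 (R : realType) N (a : R) (v : 'rV[R]_N) (B : 'M[R]_N) :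
  (forall t w, 0 <= t ^+ 2 * a + 2 * t * dot v w + dot (w *m B) w) ->
  a = 0 -> v = 0.
Proof.
move=> h a0; apply: dot_eq0; have [//|v0] := eqVneq (dot v v) 0.
(* At this value of the first coordinate the form equals -1. *)
have := h (- (dot (v *m B) v + 1) / (2 * dot v v)) v.
rewrite a0 mulr0 add0r; set q := dot (v *m B) v.
have -> : 2 * (- (q + 1) / (2 * dot v v)) * dot v v + q = -1 by field.
by rewrite ler0N1.
Qed.

(** Cholesky elimination of the first coordinate.  If the corner [a] is zero
    then so is the rest of its row; otherwise the Schur complement
    [B - a^-1 *: (v^T *m v)] is again positive semidefinite, because its value
    at [w] is the minimum over [t] of the form of [A] at [(t, w)]. *)
Lemma psd_factor (R : realType) N (A : 'M[R]_N) :
  positive_semidefinite A -> exists S : 'M[R]_N, A = S *m S^T.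
Proof.
elim: N A => [A _|N IH]; first by exists 0; apply/matrixP => -[].
rewrite -[N.+1]/(1 + N)%N => A [symA posA].
pose a := A 0 0; pose v : 'rV[R]_N := ursubmx A; pose B : 'M[R]_N := drsubmx A.
have AE : A = block_mx a%:M v v^T B.
  rewrite -[LHS]submxK; congr block_mx.
    by rewrite [LHS]mx11_scalar /a !mxE; congr (A _ _)%:M; exact/val_inj.
  by rewrite /v trmx_ursub symA.
have symB : B^T = B by rewrite /B trmx_drsub symA.
have quad t w : 0 <= t ^+ 2 * a + 2 * t * dot v w + dot (w *m B) w.
  have := posA (row_mx t%:M w); rewrite AE mul_row_block dot_row_mx.
  rewrite !dotDl !mul_scalar_mx !dotZl dot_mulmx trmxK mul_scalar_mx dotZr.
  have -> : dot a%:M t%:M = a * t by rewrite /dot big_ord1 !mxE.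
  by rewrite (dotC w v); congr (0 <= _); ring.
have a_ge0 : 0 <= a.
  by have := quad 1 0; rewrite dotC !dot0l mul0mx dot0l; lra.
have [a0|a_neq0] := eqVneq a 0.
  have v0 := psd_corner0 quad a0.
  have [|S' BE] := IH B.
    split=> // w; have := quad 0 w.
    by rewrite expr0n mul0r mulr0 mul0r !add0r.
  exists (block_mx 0 0 0 S'); rewrite AE tr_block_mx mulmx_block.
  by rewrite a0 v0 -BE !(trmx0, mul0mx, mulmx0, addr0, add0r) raddf0.
have a_gt0 : 0 < a by rewrite lt_def a_neq0.
have [|S' BE] := IH (B - a^-1 *: (v^T *m v)).
  split; first by rewrite /symmx /= linearB linearZ /= trmx_mul trmxK symB.
  (* The minimum over the first coordinate is attained here. *)
  move=> w; have := quad (- dot v w / a) w.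
  rewrite mulmxBr -scalemxAr mulmxA dotDl dotNl dotZl.
  rewrite [w *m v^T]mx11_scalar -dotE mul_scalar_mx dotZl (dotC w v).
  by congr (0 <= _); field.
have sq : Num.sqrt a * Num.sqrt a = a by rewrite -expr2 sqr_sqrtr.
have sq0 : Num.sqrt a != 0 by rewrite gt_eqF // sqrtr_gt0.
exists (block_mx (Num.sqrt a)%:M 0 ((Num.sqrt a)^-1 *: v^T) S').
rewrite AE tr_block_mx mulmx_block -BE !(trmx0, mul0mx, mulmx0, addr0).
rewrite !linearZ /= trmxK tr_scalar_mx -scalar_mxM sq.
rewrite mul_scalar_mx mul_mx_scalar !scalerA mulfV // !scale1r.
rewrite -scalemxAl scalerA -invfM sq mulVf // scale1r addrCA -scalerDr subrr.
by rewrite scaler0 addr0.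
Qed.

(** * Pure tensors and the space W^perp *)

Section Tensor.
Variables (R : realType) (m n : nat).

Lemma row_tensmx p q (A : 'M[R]_(m, p)) (B : 'M[R]_(n, q)) i j :
  row (mxtens_index (i, j)) (tensmx A B) = tensv (row i A) (row j B).
Proof. by apply/rowP => k; rewrite !mxE mxtens_indexK. Qed.

Lemma tensvE (a : 'rV[R]_m) (b : 'rV[R]_n) i j :
  tensv a b 0 (mxtens_index (i, j)) = a 0 i * b 0 j.
Proof.
by rewrite !mxE mxtens_indexK; congr (a _ _ * b _ _); exact: ord1.
Qed.

Lemma tensv_mul (a : 'rV[R]_m) (b : 'rV[R]_n) (A : 'M[R]_m) (B : 'M[R]_n) :
  tensv a b *m tensmx A B = tensv (a *m A) (b *m B).
Proof. exact: (tensmx_mul a b A B). Qed.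

Lemma big_tens_index (F : 'I_(m * n) -> R) :
  \sum_k F k = \sum_i \sum_j F (mxtens_index (i, j)).
Proof.
rewrite pair_big /= (reindex (@mxtens_index m n)).
  by apply: eq_bigr => -[].
by apply: onW_bij; exists (@mxtens_unindex m n);
  [exact: mxtens_indexK | exact: mxtens_unindexK].
Qed.

Lemma dot_tensv (a a' : 'rV[R]_m) (b b' : 'rV[R]_n) :
  dot (tensv a b) (tensv a' b') = dot a a' * dot b b'.
Proof.
rewrite /dot big_tens_index mulr_suml; apply: eq_bigr => i _.
rewrite mulr_sumr; apply: eq_bigr => j _; rewrite !tensvE.
by rewrite mulrACA.
Qed.

Lemma tensvDl (a a' : 'rV[R]_m) (b : 'rV[R]_n) :
  tensv (a + a') b = tensv a b + tensv a' b.
Proof. by apply/rowP => k; rewrite !mxE mulrDl. Qed.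

Lemma tensvDr (a : 'rV[R]_m) (b b' : 'rV[R]_n) :
  tensv a (b + b') = tensv a b + tensv a b'.
Proof. by apply/rowP => k; rewrite !mxE mulrDr. Qed.

Lemma tensvZl t (a : 'rV[R]_m) (b : 'rV[R]_n) :
  tensv (t *: a) b = t *: tensv a b.
Proof. by apply/rowP => k; rewrite !mxE mulrA. Qed.

Lemma tensvZr t (a : 'rV[R]_m) (b : 'rV[R]_n) :
  tensv a (t *: b) = t *: tensv a b.
Proof. by apply/rowP => k; rewrite !mxE mulrCA. Qed.

Lemma tensv_bilinear p (S : 'M[R]_(m * n, p)) :
  bilinear_for *:%R *:%R (fun a b => tensv a b *m S).
Proof.
by split=> [b t a a'|a t b b'] /=;
  rewrite ?(tensvDl, tensvDr, tensvZl, tensvZr) mulmxDl scalemxAl.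
Qed.

Lemma bilinear_tensv p (F : 'rV[R]_m -> 'rV[R]_n -> 'rV[R]_p) :
  bilinear_for *:%R *:%R F ->
  exists S : 'M[R]_(m * n, p), forall a b, F a b = tensv a b *m S.
Proof.
move=> [Fl Fr].
pose S : 'M[R]_(m * n, p) := \matrix_k
  F (delta_mx 0 (mxtens_unindex k).1) (delta_mx 0 (mxtens_unindex k).2).
exists S => a b.
have F_suml y (I : Type) (r : seq I) c (v : I -> 'rV[R]_m) :
    F (\sum_(i <- r) c i *: v i) y = \sum_(i <- r) c i *: F (v i) y.
  elim: r => [|i r IH]; last by rewrite !big_cons Fl IH.
  by have := Fl y (-1) 0 0; rewrite /= !big_nil !scaleN1r oppr0 addr0 addNr.
have F_sumr x (J : Type) (r : seq J) c (v : J -> 'rV[R]_n) :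
    F x (\sum_(i <- r) c i *: v i) = \sum_(i <- r) c i *: F x (v i).
  elim: r => [|i r IH]; last by rewrite !big_cons Fr IH.
  by have := Fr x (-1) 0 0; rewrite /= !big_nil !scaleN1r oppr0 addr0 addNr.
apply/rowP => l; rewrite mxE big_tens_index.
rewrite [a in LHS]row_sum_delta F_suml summxE; apply: eq_bigr => i _.
rewrite [b in LHS]row_sum_delta F_sumr mxE summxE mulr_sumr.
apply: eq_bigr => j _.
by rewrite tensvE /S !mxE mxtens_indexK mulrA.
Qed.

Section OrthonormalBases.
Variables (e : 'I_m -> 'rV[R]_m) (f : 'I_n -> 'rV[R]_n).
Hypotheses (he : orthonormal_basis e) (hf : orthonormal_basis f).

Let T : 'M[R]_(m * n) := tensmx (\matrix_i e i) (\matrix_j f j).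

Let row_T i j : row (mxtens_index (i, j)) T = tensv (e i) (f j).
Proof. by rewrite row_tensmx !rowK. Qed.

(** The vectors [e_i (x) f_j] form an orthonormal basis of [R^(mn)]: they are
    the rows of an orthogonal matrix [T], and the inner products in the
    hypothesis are the entries of [T *m c *m T^T] and [T *m d *m T^T]. *)
Lemma orthonormal_tensv_ext (c d : 'M[R]_(m * n)) :
  (forall i j k l, dot (tensv (e i) (f j) *m c) (tensv (e k) (f l)) =
                   dot (tensv (e i) (f j) *m d) (tensv (e k) (f l))) ->
  c = d.
Proof.
move=> cd.
have TT : T *m T^T = 1%:M.
  apply/matrixP => s t; rewrite gramE.
  rewrite -(mxtens_unindexK s) -(mxtens_unindexK t).
  case: (mxtens_unindex s) => i j; case: (mxtens_unindex t) => k l.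
  rewrite !row_T dot_tensv he hf !mxE (can_eq (@mxtens_indexK m n)) xpair_eqE.
  by rewrite -natrM mulnb.
have TcT : T *m c *m T^T = T *m d *m T^T.
  apply/matrixP => s t.
  have E (x : 'M[R]_(m * n)) :
      (T *m x *m T^T) s t = dot (row s T *m x) (row t T).
    by rewrite dotE -row_mul tr_row !mxE; apply: eq_bigr => i _; rewrite !mxE.
  rewrite !E -(mxtens_unindexK s) -(mxtens_unindexK t).
  case: (mxtens_unindex s) => i j; case: (mxtens_unindex t) => k l.
  by rewrite !row_T.
have TtT := mulmx1C TT.
have := congr1 (fun x => T^T *m x *m T) TcT.
by rewrite /= -!mulmxA TtT !mulmx1 !mulmxA TtT !mul1mx.
Qed.

Lemma dot_symprod N (x y u v : 'rV[R]_N) :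
  dot (x *m symprod u v) y =
  2^-1 * (dot x u * dot v y + dot x v * dot u y).
Proof.
rewrite /symprod -scalemxAr dotZl mulmxDr !mulmxA dotDl.
rewrite [x *m u^T]mx11_scalar [x *m v^T]mx11_scalar -!dotE.
by rewrite !mul_scalar_mx !dotZl.
Qed.

Let sum_deltal (I : finType) (i : I) (F : I -> R) :
  \sum_j (i == j)%:R * F j = F i.
Proof.
rewrite (bigD1 i) //= eqxx mul1r big1 ?addr0 // => j ji.
by rewrite eq_sym (negbTE ji) mul0r.
Qed.

(** Symmetry of [q] under exchange of the index pairs is needed because
    [symprod] symmetrizes: the coefficient obtained is the average of
    [q i j k l] and [q k l i j]. *)
Lemma quad_tensor_coef (q : 'I_m -> 'I_n -> 'I_m -> 'I_n -> R) i j k l :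
  (forall i j k l, q i j k l = q k l i j) ->
  dot (tensv (e i) (f j) *m quad_tensor e f q) (tensv (e k) (f l)) = q i j k l.
Proof.
move=> qsym; rewrite /quad_tensor.
have sumE : dot (tensv (e i) (f j) *m quad_tensor e f q) (tensv (e k) (f l)) =
    2^-1 * (\sum_i' (i == i')%:R * \sum_j' (j == j')%:R *
             \sum_k' (k == k')%:R * \sum_l' (l == l')%:R * q i' j' k' l') +
    2^-1 * (\sum_i' (k == i')%:R * \sum_j' (l == j')%:R *
             \sum_k' (i == k')%:R * \sum_l' (j == l')%:R * q i' j' k' l').
  rewrite /quad_tensor mulmx_sumr dot_suml !mulr_sumr -big_split /=.
  apply: eq_bigr => i' _.
  rewrite mulmx_sumr dot_suml !mulr_sumr -big_split /=; apply: eq_bigr => j' _.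
  rewrite mulmx_sumr dot_suml !mulr_sumr -big_split /=; apply: eq_bigr => k' _.
  rewrite mulmx_sumr dot_suml !mulr_sumr -big_split /=; apply: eq_bigr => l' _.
  rewrite -scalemxAr dotZl dot_symprod !dot_tensv !he !hf.
  rewrite (eq_sym k' k) (eq_sym l' l) (eq_sym i' k) (eq_sym j' l); ring.
by rewrite sumE !sum_deltal (qsym k l); field.
Qed.

End OrthonormalBases.

(** The pairing of [c] with [symprod u u] is the quadratic form of [c] at
    [u]. *)
Lemma WperpP (c : 'M[R]_(m * n)) :
  Wperp c <-> c^T = c /\
    forall a b, dot (tensv a b *m c) (tensv a b) = 0.
Proof.
have trE (u : 'rV[R]_(m * n)) : \tr (c *m (symprod u u)^T) = dot (u *m c) u.
  have -> : (symprod u u)^T = u^T *m u.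
    rewrite /symprod linearZ linearD /= trmx_mul trmxK.
    have half2 : 2^-1 + 2^-1 = 1 :> R by field.
    by rewrite scalerDr -scalerDl half2 scale1r.
  rewrite mulmxA mxtrace_mulC mulmxA [_ *m u^T]mx11_scalar mxtrace_scalar.
  by rewrite dotE.
split=> [[symc Wc]|[symc Wc]]; split => //.
  move=> a b; rewrite -trE; apply: Wc.
  exists 1%N, (fun=> 1), (fun=> symprod (tensv a b) (tensv a b)).
  by split; [move=> _; exists a, b | rewrite big_ord1 scale1r].
move=> _ [k [t [v [hv ->]]]].
rewrite linear_sum /= mulmx_sumr linear_sum big1 //= => i _.
have [a [b ->]] := hv i.
by rewrite linearZ /= -scalemxAr linearZ /= trE Wc mulr0.
Qed.

(** Polarization of the quadratic form, which vanishes on pure tensors, in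
    the first factor alone, then in the second one. *)
Lemma Wperp_skew (c : 'M[R]_(m * n)) : Wperp c ->
  (forall a b a' b', dot (tensv a b *m c) (tensv a' b') =
                     - dot (tensv a' b *m c) (tensv a b')) /\
  (forall a b a' b', dot (tensv a b *m c) (tensv a' b') =
                     - dot (tensv a b' *m c) (tensv a' b)).
Proof.
move=> /WperpP[symc Wc].
have sym u v : dot (u *m c) v = dot (v *m c) u.
  by rewrite dot_mulmx symc dotC.
have W1 a a' b : dot (tensv a b *m c) (tensv a' b) = 0.
  have := Wc (a + a') b; rewrite !tensvDl !mulmxDl !dotDl !dotDr !Wc.
  by rewrite (sym (tensv a' b)); lra.
have W2 a b a' b' : dot (tensv a b *m c) (tensv a' b') =
    - dot (tensv a b' *m c) (tensv a' b).
  have := W1 a a' (b + b'); rewrite !tensvDr !mulmxDl !dotDl !dotDr !W1; lra.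
by split=> a b a' b' //; rewrite W2 sym.
Qed.

Lemma wedge_Wperp_bij (e : 'I_m -> 'rV[R]_m) (f : 'I_n -> 'rV[R]_n) :
  orthonormal_basis e -> orthonormal_basis f ->
  set_bij (@wedge2_tensor_wedge2 R m n) (@Wperp R m n)
    (fun b => quad_tensor e f (fun i j k l => b i k j l)).
Proof.
move=> he hf.
have coef b i j k l : wedge2_tensor_wedge2 b ->
    dot (tensv (e i) (f j) *m quad_tensor e f (fun i j k l => b i k j l))
      (tensv (e k) (f l)) = b i k j l.
  move=> [b1 b2]; rewrite quad_tensor_coef // => i' j' k' l'.
  by rewrite b1 b2 opprK.
split.
- move=> b hb; apply/WperpP; set c := quad_tensor _ _ _.
  have symc : c^T = c.
    rewrite /c /quad_tensor; do 4 (rewrite linear_sum; apply: eq_bigr => ? _).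
    by rewrite linearZ /symprod linearZ linearD /= !trmx_mul !trmxK addrC.
  split=> // x y.
  (* Expanded over the bases, the quadratic form at a pure tensor pairs [b],
     which is skew in [i] and [k], with coefficients symmetric in them. *)
  pose G i j k l :=
    b i k j l * (dot x (e i) * dot y (f j) * (dot x (e k) * dot y (f l))).
  have -> : dot (tensv x y *m c) (tensv x y) =
      \sum_j \sum_i \sum_k \sum_l G i j k l.
    rewrite exchange_big /c /quad_tensor /=.
    do 4 (rewrite mulmx_sumr dot_suml; apply: eq_bigr => ? _).
    rewrite -scalemxAr dotZl dot_symprod !dot_tensv /G !(dotC x) !(dotC y).
    by congr (_ * _); field.
  rewrite big1 // => j _; set s := \sum_i _.
  suff : s = - s by lra.
  rewrite {1}/s exchange_big /s -sumrN; apply: eq_bigr => i _.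
  rewrite -sumrN; apply: eq_bigr => k _; rewrite -sumrN; apply: eq_bigr => l _.
  by rewrite /G (proj1 hb); ring.
- move=> b b'; rewrite !inE => hb hb' bb'.
  apply/funext => i; apply/funext => k; apply/funext => j; apply/funext => l.
  by rewrite -[LHS](coef b) // bb' coef.
- move=> c hc; have [sk1 sk2] := Wperp_skew hc.
  pose b i k j l := dot (tensv (e i) (f j) *m c) (tensv (e k) (f l)).
  have hb : wedge2_tensor_wedge2 b by split=> i k j l; rewrite /b.
  exists b => //; apply: (orthonormal_tensv_ext he hf) => i j k l.
  by rewrite coef.
Qed.

End Tensor.

(** * Orthogonal multiplications as Gram matrices *)

Section GramMatrix.
Variables (R : realType) (m n : nat).
Implicit Types F G : orthmult R m n.

Lemma sqr_enorm N (u : 'rV[R]_N) : enorm u ^+ 2 = dot u u.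
Proof. by rewrite sqr_sqrtr // dot_ge0. Qed.

Lemma dot_om_ext F x y x' y' :
  dot (om_ext F x y) (om_ext F x' y') = dot (om_map F x y) (om_map F x' y').
Proof.
rewrite dot_mulmx -mulmxA tr_pid_mx mul_pid_mx.
by rewrite !(minn_idPr _) ?minnn ?om_dim_le // pid_mx_1 mulmx1.
Qed.

Lemma om_ext_norm F x y :
  dot (om_ext F x y) (om_ext F x y) = dot x x * dot y y.
Proof.
have [_ normF] := om_axiom F.
by rewrite dot_om_ext -sqr_enorm normF exprMn !sqr_enorm.
Qed.

Lemma om_ext_bilinear F : bilinear_for *:%R *:%R (om_ext F).
Proof.
have [[Fl Fr] _] := om_axiom F.
by split=> [y t x x'|x t y y'] /=; rewrite /om_ext ?Fl ?Fr mulmxDl scalemxAl.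
Qed.

(** The matrix of the linear map on [R^m (x) R^n] that [om_ext F] induces;
    [om_extE] shows that it exists. *)
Definition om_mx F : 'M[R]_(m * n) :=
  xget 0 [set S | forall x y, om_ext F x y = tensv x y *m S].

Lemma om_extE F x y : om_ext F x y = tensv x y *m om_mx F.
Proof.
have [S hS] := bilinear_tensv (om_ext_bilinear F).
have := @xgetPex _ 0 [set S | forall x y, om_ext F x y = tensv x y *m S].
by move=> /(_ (ex_intro _ S hS)); exact.
Qed.

Lemma delta_tensv (k : 'I_(m * n)) :
  delta_mx 0 k = tensv (delta_mx 0 (mxtens_unindex k).1)
                       (delta_mx 0 (mxtens_unindex k).2) :> 'rV[R]_(m * n).
Proof.
rewrite -[k in LHS]mxtens_unindexK; case: (mxtens_unindex k) => i j.
apply/rowP => s; rewrite -(mxtens_unindexK s); case: (mxtens_unindex s) => a b.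
rewrite tensvE !mxE !eqxx /= (can_eq (@mxtens_indexK m n)) xpair_eqE.
by rewrite -natrM mulnb.
Qed.

Lemma eq_tensv_mx p (S T : 'M[R]_(m * n, p)) :
  (forall x y, tensv x y *m S = tensv x y *m T) -> S = T.
Proof.
by move=> ST; apply/row_matrixP => k; rewrite !rowE delta_tensv ST.
Qed.

Lemma om_tensorE (e : 'I_m -> 'rV[R]_m) (f : 'I_n -> 'rV[R]_n) F :
  orthonormal_basis e -> orthonormal_basis f ->
  om_tensor e f F = om_mx F *m (om_mx F)^T - 1%:M.
Proof.
move=> he hf; apply: (orthonormal_tensv_ext he hf) => i j k l.
rewrite quad_tensor_coef //.
  rewrite mulmxBr mulmx1 dotDl dotNl dot_gram -!om_extE dot_om_ext.
  by rewrite dot_tensv he hf.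
move=> i' j' k' l'.
by rewrite dotC (eq_sym i') (eq_sym j').
Qed.

(** The quadratic form of [S *m S^T - 1] at a pure tensor [x (x) y] is
    [|(x (x) y) S|^2 - |x|^2 |y|^2]. *)
Lemma moduli_body_gram (S : 'M[R]_(m * n)) :
  moduli_body (S *m S^T - 1%:M) <->
  forall x y, dot (tensv x y *m S) (tensv x y *m S) = dot x x * dot y y.
Proof.
have E x y : dot (tensv x y *m (S *m S^T - 1%:M)) (tensv x y) =
    dot (tensv x y *m S) (tensv x y *m S) - dot x x * dot y y.
  by rewrite mulmxBr mulmx1 dotDl dotNl dot_gram dot_tensv.
split=> [[/WperpP[_ W] _] x y|nS].
  by apply/eqP; rewrite -subr_eq0 -E W.
split; last first.
  rewrite addrC subrK; split; first by rewrite /symmx /= trmx_mul trmxK.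
  by move=> w; rewrite dot_gram dot_ge0.
apply/WperpP; split; first by rewrite linearB /= trmx_mul trmxK trmx1.
by move=> x y; rewrite E nS subrr.
Qed.

Lemma om_gram_moduli_body F :
  moduli_body (om_mx F *m (om_mx F)^T - 1%:M).
Proof. by apply/moduli_body_gram => x y; rewrite -om_extE om_ext_norm. Qed.

(** A factorization [1 + c = S *m S^T] gives the multiplication
    [(x, y) |-> (x (x) y) S], of type [m, n, mn]; positivity of [m] ensures
    [n <= mn]. *)
Lemma moduli_body_om (c : 'M[R]_(m * n)) : (0 < m)%N -> moduli_body c ->
  exists F, om_mx F *m (om_mx F)^T - 1%:M = c.
Proof.
move=> m_gt0 hc.
have [S SE] := psd_factor hc.2.
have cE : c = S *m S^T - 1%:M by rewrite -SE addrC addKr.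
have nS : is_orthogonal_multiplication (fun x y => tensv x y *m S).
  split=> [|x y]; first exact: tensv_bilinear.
  rewrite cE in hc; move/moduli_body_gram : hc => hc.
  by rewrite /enorm hc sqrtrM // dot_ge0.
pose F := OrthMult (leq_pmull n m_gt0) (leqnn (m * n)) nS.
exists F; rewrite cE; suff -> : om_mx F = S by [].
apply: eq_tensv_mx => x y; rewrite -om_extE /om_ext /=.
by rewrite pid_mx_1 mulmx1.
Qed.

Lemma range_equivP F G :
  range_equiv F G <->
  om_mx F *m (om_mx F)^T = om_mx G *m (om_mx G)^T.
Proof.
split=> [[U hU GF]|FG].
  have -> : om_mx G = om_mx F *m U.
    by apply: eq_tensv_mx => x y; rewrite mulmxA -!om_extE.
  by rewrite trmx_mul mulmxA -(mulmxA _ U) hU mulmx1.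
have [U hU GE] := gram_eq_orthogonal FG.
by exists U => // x y; rewrite !om_extE GE mulmxA.
Qed.

Lemma tensmx11 : tensmx 1%:M 1%:M = 1%:M :> 'M[R]_(m * n).
Proof.
apply/row_matrixP => k; rewrite !rowE mulmx1 delta_tensv tensv_mul.
by rewrite !mulmx1.
Qed.

Lemma SO_tensor_orthogonal (g : 'M[R]_(m * n)) :
  SO_tensor_SO g -> orthogonal_group g.
Proof.
move=> [A [B [[hA _] [hB _] ->]]]; rewrite /orthogonal_group /= trmx_tens.
by rewrite tensmx_mul hA hB tensmx11.
Qed.

Lemma domain_range_equivP F G :
  domain_range_equiv F G <->
  SO_orbit_rel (om_mx F *m (om_mx F)^T - 1%:M) (om_mx G *m (om_mx G)^T - 1%:M).
Proof.
have actE g : orthogonal_group g ->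
    sym_act g (om_mx F *m (om_mx F)^T - 1%:M) =
    g *m om_mx F *m (g *m om_mx F)^T - 1%:M.
  by move=> hg; rewrite /sym_act mulmxBr mulmx1 mulmxBl hg trmx_mul !mulmxA.
split=> [[A [B [U [hA hB hU GF]]]]|[g hg]].
  have hg : SO_tensor_SO (tensmx A B) by exists A, B.
  exists (tensmx A B); rewrite // (actE _ (SO_tensor_orthogonal hg)).
  have -> : om_mx G = tensmx A B *m om_mx F *m U.
    apply: eq_tensv_mx => x y.
    by rewrite !mulmxA tensv_mul -!om_extE GF.
  by rewrite trmx_mul !mulmxA -(mulmxA _ U) hU mulmx1.
rewrite (actE _ (SO_tensor_orthogonal hg)) => /addIr/esym/gram_eq_orthogonal.
move: hg => [A [B [hA hB ->]]] [U hU GE].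
exists A, B, U; split => // x y.
by rewrite !om_extE GE !mulmxA tensv_mul.
Qed.

Lemma special_orthogonal1 N : special_orthogonal_group (1%:M : 'M[R]_N).
Proof. by split; [exact: orthogonal_group1 | exact: det1]. Qed.

Lemma special_orthogonalM N (A B : 'M[R]_N) :
  special_orthogonal_group A -> special_orthogonal_group B ->
  special_orthogonal_group (A *m B).
Proof.
move=> [hA dA] [hB dB]; split; first exact: orthogonal_groupM.
by rewrite det_mulmx dA dB mulr1.
Qed.

Lemma special_orthogonalT N (A : 'M[R]_N) :
  special_orthogonal_group A -> special_orthogonal_group A^T.
Proof.
by move=> [hA dA]; split; [exact: orthogonal_groupT | rewrite det_tr].
Qed.

Lemma SO_orbit_relxx (c : 'M[R]_(m * n)) : SO_orbit_rel c c.
Proof.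
exists 1%:M; last by rewrite /sym_act mul1mx trmx1 mulmx1.
exists 1%:M, 1%:M; split; try exact: special_orthogonal1.
by rewrite tensmx11.
Qed.

Lemma SO_orbit_rel_sym (c d : 'M[R]_(m * n)) :
  SO_orbit_rel c d -> SO_orbit_rel d c.
Proof.
move=> [g hg ->]; have /mulmx1C gg := SO_tensor_orthogonal hg.
exists g^T.
  move: hg => [A [B [hA hB ->]]]; exists A^T, B^T.
  by rewrite trmx_tens; split; try exact: special_orthogonalT.
by rewrite /sym_act trmxK !mulmxA gg mul1mx -mulmxA gg mulmx1.
Qed.

Lemma SO_orbit_rel_trans (c d b : 'M[R]_(m * n)) :
  SO_orbit_rel c d -> SO_orbit_rel d b -> SO_orbit_rel c b.
Proof.
move=> [g hg ->] [h hh ->]; exists (h *m g); last first.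
  by rewrite /sym_act trmx_mul !mulmxA.
move: hg hh => [A [B [hA hB ->]]] [A' [B' [hA' hB' ->]]].
exists (A' *m A), (B' *m B).
by rewrite tensmx_mul; split; try exact: special_orthogonalM.
Qed.

Lemma sym_act_moduli_body (g c : 'M[R]_(m * n)) :
  SO_tensor_SO g -> moduli_body c -> moduli_body (sym_act g c).
Proof.
move=> hg [/WperpP[symc Wc] [symc1 posc]].
have gO := SO_tensor_orthogonal hg.
have actE u : dot (u *m sym_act g c) u = dot (u *m g *m c) (u *m g).
  by rewrite /sym_act !mulmxA dot_mulmx trmxK.
have sym_gc : (sym_act g c)^T = sym_act g c.
  by rewrite /sym_act !trmx_mul trmxK symc mulmxA.
split.
  apply/WperpP; split => // a b; rewrite actE.
  by move: hg => [A [B [_ _ ->]]]; rewrite tensv_mul.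
split; first by rewrite /symmx /= linearD /= trmx1 sym_gc.
move=> w; have := posc (w *m g).
rewrite !mulmxDr !mulmx1 !dotDl actE.
by rewrite [X in 0 <= X + _ -> _]dot_mulmx -mulmxA gO mulmx1.
Qed.

(** The span of the image of [F] is the row space of [om_mx F], as pure
    tensors span [R^(mn)]. *)
Lemma full_in_mnP F : full_in_mn F <-> om_mx F \in unitmx.
Proof.
split=> [fullF|unitF].
  rewrite -row_full_unit -sub1mx; apply/row_subP => i.
  have : [set: 'rV[R]_(m * n)] (row i 1%:M) by [].
  rewrite -fullF => -[k [a [v [hv ->]]]].
  apply: summx_sub => j _; apply: scalemx_sub.
  by have [x [y ->]] := hv j; rewrite om_extE submxMl.
apply/seteqP; split=> // w _.
pose E (k : 'I_(m * n)) := om_ext F (delta_mx 0 (mxtens_unindex k).1)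
                                     (delta_mx 0 (mxtens_unindex k).2).
exists (m * n)%N, (fun k => (w *m invmx (om_mx F)) 0 k), E; split.
  by move=> i; eexists; eexists.
rewrite -[LHS](mulmxKV unitF) mulmx_sum_row; apply: eq_bigr => k _.
by rewrite /E om_extE rowE -delta_tensv.
Qed.

End GramMatrix.

(** * Quotients *)

(** A map whose fibres are the classes of [E] induces a bijection from the
    quotient to its image; [s0] is only the value at sets that are not
    classes. *)
Lemma quotient_set_bij (T : Type) (S : choiceType) (s0 : S)
    (E : T -> T -> Prop) (phi : T -> S) (B : set S) :
  (forall x y, E x y <-> phi x = phi y) -> phi @` setT = B ->
  exists Phi : set T -> S,
    (forall x, Phi [set y | setT y /\ E x y] = phi x) /\
    set_bij (quotient_set setT E) B Phi.
Proof.
move=> Ephi <-.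
have [Phi PhiE] : exists Phi : set T -> S,
    forall x, Phi [set y | setT y /\ E x y] = phi x.
  exists (fun A => xget s0 [set s | exists2 x, A x & s = phi x]) => x.
  apply: xget_unique; last by move=> _ [y [_ /Ephi xy] ->].
  by exists x => //; split=> //; apply/Ephi.
exists Phi; split=> //; split.
- by move=> _ [x _ <-]; rewrite PhiE; exists x.
- move=> A A'; rewrite !inE => -[x _ <-] [y _ <-]; rewrite !PhiE => xy.
  by apply/seteqP; split=> z [_ /Ephi]; [rewrite xy|rewrite -xy];
    move=> yz; split=> //; apply/Ephi.
- by move=> _ [x _ <-]; exists [set y | setT y /\ E x y]; [exists x|].
Qed.

(** * Compactness, convexity and interior of the moduli body *)

Section Topology.
Variables (R : realType).

Lemma quad_form_continuous N (u v : 'rV[R]_N) :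
  continuous (fun c : 'M[R]_N => dot (u *m c) v).
Proof.
have -> : (fun c : 'M[R]_N => dot (u *m c) v) =
    \sum_i \sum_j (fun c : 'M[R]_N => u 0 i * c i j * v 0 j).
  apply/funext => c; rewrite quad_formE fct_sumE; apply: eq_bigr => i _.
  by rewrite fct_sumE.
elim/big_ind : _ => [c|F G cF cG c|i _].
- exact: (@cst_continuous _ _ (0 : R)).
- exact: cvgD (cF c) (cG c).
elim/big_ind : _ => [c|F G cF cG c|j _ c].
- exact: (@cst_continuous _ _ (0 : R)).
- exact: cvgD (cF c) (cG c).
apply: (@cvgM R _ (nbhs c) _ (fun c : 'M[R]_N => u 0 i * c i j) (fun=> v 0 j)).
  apply: (@cvgM R _ (nbhs c) _ (fun=> u 0 i) (fun c : 'M[R]_N => c i j)).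
    exact: cvg_cst.
  exact: coord_continuous.
exact: cvg_cst.
Qed.

Lemma vec_mx_continuous p q : continuous (@vec_mx R p q).
Proof.
move=> v A /nbhs_ballP[eps eps0 epsA].
apply/nbhs_ballP; exists eps => // w [_ vw].
by apply: epsA; split=> // i j; rewrite !mxE; exact: vw.
Qed.

(** Transported along [vec_mx] from the compactness of boxes of row
    vectors. *)
Lemma unit_box_compact p q :
  compact [set c : 'M[R]_(p, q) | forall i j, -1 <= c i j <= 1].
Proof.
have -> : [set c : 'M[R]_(p, q) | forall i j, -1 <= c i j <= 1] =
    vec_mx @` [set v : 'rV[R]_(p * q) | forall k, `[-1, 1]%classic (v 0 k)].
  apply/seteqP; split=> [c hc|_ [v hv <-] i j].
    exists (mxvec c); last exact: mxvecK.
    move=> k; case/mxvec_indexP: k => i j; rewrite mxvecE.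
    by rewrite /= in_itv /= hc.
  by rewrite mxE; have := hv (mxvec_index i j); rewrite /= in_itv.
apply: continuous_compact.
  by apply: continuous_subspaceT; exact: vec_mx_continuous.
have := @rV_compact R (p * q) (fun=> `[-1, 1]%classic).
by apply=> _; exact: segment_compact.
Qed.

Variables (m n : nat).

(** The diagonal of [c] vanishes since the standard basis vectors are pure
    tensors; positivity of [1 + c] at [e_i + e_j] and [e_i - e_j] then bounds
    the entry [c i j]. *)
Lemma moduli_body_box (c : 'M[R]_(m * n)) :
  moduli_body c -> forall i j, -1 <= c i j <= 1.
Proof.
move=> [/WperpP[symc Wc] [_ posc]] i j.
have symE : c j i = c i j by rewrite -[in LHS]symc mxE.
have diag k : c k k = 0 by rewrite -dot_deltamx delta_tensv Wc.
have E s : 0 <= dot (delta_mx 0 i) (delta_mx 0 i) +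
    s ^+ 2 * dot (delta_mx 0 j) (delta_mx 0 j) +
    2 * s * (dot (delta_mx 0 i) (delta_mx 0 j) + c i j).
  have := posc (delta_mx 0 i + s *: delta_mx 0 j).
  rewrite mulmxDr mulmx1 mulmxDl -scalemxAl.
  rewrite !(dotDl, dotDr, dotZl, dotZr) !dot_deltamx !diag symE.
  by rewrite (dotC (delta_mx 0 j) (delta_mx 0 i)); congr (0 <= _); ring.
have := E 1; have := E (-1).
rewrite !dot_delta !mxE !eqxx /=; have [->|_] := eqVneq i j.
  by rewrite diag; lra.
by rewrite /=; lra.
Qed.

Lemma moduli_body_closed : closed (@moduli_body R m n).
Proof.
pose C := \bigcap_(p in [set: 'rV[R]_(m * n) * 'rV[R]_(m * n)])
    [set c : 'M[R]_(m * n) | dot (p.1 *m c) p.2 - dot (p.2 *m c) p.1 = 0] `&`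
  (\bigcap_(p in [set: 'rV[R]_m * 'rV[R]_n])
    [set c : 'M[R]_(m * n) |
      dot (tensv p.1 p.2 *m c) (tensv p.1 p.2) = 0] `&`
  \bigcap_(w in [set: 'rV[R]_(m * n)])
    [set c : 'M[R]_(m * n) | 0 <= dot w w + dot (w *m c) w]).
suff -> : @moduli_body R m n = C.
  apply: closedI; last apply: closedI.
  - apply: closed_bigI => p _; apply: (closed_comp _ (@closed_eq R 0)) => c _.
    exact: cvgB (@quad_form_continuous _ p.1 p.2 c)
      (@quad_form_continuous _ p.2 p.1 c).
  - apply: closed_bigI => p _; apply: (closed_comp _ (@closed_eq R 0)) => c _.
    exact: quad_form_continuous.
  - apply: closed_bigI => w _; apply: (closed_comp _ (@closed_ge R 0)) => c _.
    exact: cvgD (@cvg_cst _ (dot w w) _ (nbhs c) _)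
      (@quad_form_continuous _ w w c).
apply/seteqP; split=> [c [/WperpP[symc Wc] [_ posc]]|c [sc [Wc pc]]].
  split=> [p _|]; first by rewrite /= dot_mulmx symc dotC subrr.
  split=> [p _|w _]; first exact: Wc.
  by have := posc w; rewrite mulmxDr mulmx1 dotDl.
have symc : c^T = c.
  apply/matrixP => i j; rewrite mxE -!dot_deltamx; apply/eqP; rewrite -subr_eq0.
  by apply/eqP/(sc (_, _)).
split; first by apply/WperpP; split=> // a b; exact: (Wc (a, b)).
split; first by rewrite /symmx /= linearD /= trmx1 symc.
by move=> w; rewrite mulmxDr mulmx1 dotDl; exact: pc.
Qed.

Lemma moduli_body_compact : compact (@moduli_body R m n).
Proof.
apply: subclosed_compact moduli_body_closed (@unit_box_compact _ _) _.
exact: moduli_body_box.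
Qed.

Lemma moduli_body_convex :
  convex_set (@moduli_body R m n : set (convex_lmodType 'M[R]_(m * n))).
Proof.
move=> c d t; rewrite !inE => -[/WperpP[symc Wc] [_ posc]].
move=> [/WperpP[symd Wd] [_ posd]].
have [s [s0 s1 ->]] : exists s : R, [/\ 0 <= s, s <= 1 &
    conv t c d = s *: (c : 'M[R]_(m * n)) + (1 - s) *: (d : 'M[R]_(m * n))].
  by exists t%:num; split.
set z := _ + _.
have E u v : dot (u *m z) v = s * dot (u *m c) v + (1 - s) * dot (u *m d) v.
  by rewrite mulmxDr -!scalemxAr dotDl !dotZl.
have sym : z^T = z by rewrite linearD !linearZ /= symc symd.
clearbody z.
split; first by apply/WperpP; split=> // a b; rewrite E Wc Wd !mulr0 addr0.
split; first by rewrite /symmx /= linearD /= trmx1 sym.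
move=> w; have := posc w; have := posd w.
rewrite !mulmxDr !mulmx1 !dotDl E.
set p := dot w w; set x := dot (w *m c) w; set y := dot (w *m d) w.
move=> hy hx.
have -> : p + (s * x + (1 - s) * y) = s * (p + x) + (1 - s) * (p + y) by ring.
by rewrite addr_ge0 // mulr_ge0 // subr_ge0.
Qed.

(** In one direction, [(1 + t) c] stays in the body for some [t > 0], and a
    null vector [w] of [1 + c] satisfies
    [<w (1 + (1 + t) c), w> = - t |w|^2], which forces [w = 0].  In the other,
    a factorization [1 + c = S *m S^T] with [S] invertible shows that the form
    of [1 + c] dominates a positive multiple of [dot w w], hence absorbs the
    form of a small [d - c]. *)
Lemma moduli_body_interior (c : 'M[R]_(m * n)) :
  interior_in (@Wperp R m n) (@moduli_body R m n) c <->
  moduli_body c /\ 1%:M + c \in unitmx.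
Proof.
have nbhsE (x : 'M[R]_(m * n)) : Wperp x ->
  interior_in (@Wperp R m n) (@moduli_body R m n) x <->
  nbhs x [set y | Wperp y -> moduli_body y].
  move=> Wx; rewrite /interior_in /interior /=.
  by rewrite /nbhs /= -(nbhs_subspace_in Wx).
split=> [ic|[bc uc]].
  have bc : moduli_body c by exact: (interior_subset ic).
  split=> //; have [Wc [_ posc]] := bc.
  move/(nbhsE _ Wc) : ic => /nbhs_ballP[eps /= eps0 ball_sub].
  have [symc Wc0] := iffLR (WperpP _) Wc.
  have t0 : 0 < eps / 2 by rewrite divr_gt0.
  set t := eps / 2 in t0.
  have [_ [_ pos_t]] : moduli_body ((1 + t) *: c).
    apply: ball_sub.
      split=> // i j; rewrite mxE /ball /= mulrDl mul1r opprD addNKr normrN.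
      rewrite normrM gtr0_norm //; have := moduli_body_box bc i j.
      rewrite -ler_norml => cij; rewrite /t mulrAC ltr_pdivrMr //.
      by rewrite ltr_pM2l // (le_lt_trans cij) // ltr1n.
    apply/WperpP; split; first by rewrite linearZ /= symc.
    by move=> a b; rewrite -scalemxAr dotZl Wc0 mulr0.
  rewrite -row_free_unit -kermx_eq0; apply/eqP/row_matrixP => i; rewrite row0.
  set w := row i _; have wc : w + w *m c = 0.
    have : w *m (1%:M + c) = 0.
      by apply/sub_kermxP; exact: row_sub.
    by rewrite mulmxDr mulmx1.
  apply: dot_eq0; apply/eqP; rewrite eq_le dot_ge0 andbT.
  have := pos_t w; rewrite mulmxDr mulmx1 -scalemxAr dotDl dotZl.
  have -> : w *m c = - w by apply/eqP; rewrite -addr_eq0 addrC wc.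
  rewrite dotNl => h.
  have : t * dot w w <= 0 by lra.
  by rewrite pmulr_rle0.
have [Wc [symc posc]] := bc.
apply/(nbhsE _ Wc).
have [S SE] := psd_factor bc.2.
have uS : S \in unitmx.
  by move: uc; rewrite SE unitmx_mul => /andP[].
pose X := invmx S *m (invmx S)^T.
pose b := \sum_i \sum_j `|X i j|.
have b0 : 0 <= b by apply: sumr_ge0 => i _; apply: sumr_ge0.
have Xb i j : `|X i j| <= b.
  rewrite /b (bigD1 i) //= (bigD1 j) //= -addrA lerDl addr_ge0 //.
    exact: sumr_ge0.
  by apply: sumr_ge0 => k _; apply: sumr_ge0.
pose K := ((m * n)%:R ^+ 2 : R).
have K0 : 0 <= K by rewrite sqr_ge0.
have coercive w : dot w w <= K * b * dot (w *m (1%:M + c)) w.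
  rewrite SE dot_gram.
  have {1 2}-> : w = w *m S *m invmx S by rewrite mulmxK.
  rewrite -dot_gram; apply: le_trans (ler_norm _) _.
  exact: quad_form_bound.
(* [dot w w] is at most [K * b] times the form of [1 + c] at [w], and the
   form of [d - c] at [w] is at most [K * eps * dot w w]: this [eps] makes the
   product of the two constants at most 1. *)
pose eps := (K * (K * b) + 1)^-1.
have eps0 : 0 < eps.
  by rewrite invr_gt0 ltr_wpDl // mulr_ge0 // mulr_ge0.
apply/nbhs_ballP; exists eps => //= d [_ cd] Wd; split=> //.
have [symd _] := iffLR (WperpP _) Wd.
split; first by rewrite /symmx /= linearD /= trmx1 symd.
move=> w.
have dc : `|dot (w *m (d - c)) w| <= K * eps * dot w w.
  apply: quad_form_bound => i j; rewrite !mxE distrC.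
  by have := cd i j; rewrite /ball /= => /ltW.
have -> : 1%:M + d = (1%:M + c) + (d - c) by rewrite addrACA subrr addr0.
rewrite mulmxDr dotDl.
set q := dot (w *m (1%:M + c)) w; have q0 : 0 <= q by exact: posc.
move: dc; rewrite ler_norml => /andP[dc _].
suff : K * eps * dot w w <= q by lra.
apply: (@le_trans _ _ (K * eps * (K * b * q))).
  by apply: ler_wpM2l (coercive w); rewrite mulr_ge0 // ltW.
have -> : K * eps * (K * b * q) = (K * (K * b) * eps) * q by ring.
apply: ler_piMl => //; rewrite /eps ler_pdivrMr ?mul1r ?lerDl //.
by rewrite -invr_gt0.
Qed.

End Topology.

(** * The moduli space *)

Theorem mainTheorem1 (R : realType) (m n : nat)
    (m_gt0 : (0 < m)%N) (le_mn : (m <= n)%N)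
    (e : 'I_m -> 'rV[R]_m) (f : 'I_n -> 'rV[R]_n)
    (he : orthonormal_basis e) (hf : orthonormal_basis f) :
  (* W^perp is wedge^2 R^m (x) wedge^2 R^n, via c_(ij,kl) = [ik,jl] *)
  set_bij (@wedge2_tensor_wedge2 R m n) (@Wperp R m n)
    (fun b => quad_tensor e f (fun i j k l => b i k j l)) /\
  (* F |-> c identifies the range equivalence classes with C *)
  (exists Phi : set (orthmult R m n) -> 'M[R]_(m * n),
    (forall F : orthmult R m n,
       Phi [set G | setT G /\ range_equiv F G] = om_tensor e f F) /\
    set_bij (quotient_set setT (@range_equiv R m n)) (@moduli_body R m n)
      Phi) /\
  compact (@moduli_body R m n) /\
  convex_set (@moduli_body R m n : set (convex_lmodType 'M[R]_(m * n))) /\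
  (* interior and boundary relative to the linear space W^perp *)
  interior_in (@Wperp R m n) (@moduli_body R m n) =
    [set om_tensor e f F | F in [set F | full_in_mn F]] /\
  [set om_tensor e f F | F in [set F | ~ full_in_mn F]] `<=`
    boundary_in (@Wperp R m n) (@moduli_body R m n) /\
  (forall g c : 'M[R]_(m * n),
     @SO_tensor_SO R m n g -> moduli_body c -> moduli_body (sym_act g c)) /\
  (* the moduli space up to domain and range equivalence *)
  (exists Psi : set (orthmult R m n) -> set 'M[R]_(m * n),
    (forall F : orthmult R m n,
       Psi [set G | setT G /\ domain_range_equiv F G] =
       [set d | moduli_body d /\ SO_orbit_rel (om_tensor e f F) d]) /\
    set_bij (quotient_set setT (@domain_range_equiv R m n))
      (quotient_set (@moduli_body R m n) (@SO_orbit_rel R m n)) Psi).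
Proof.
have OTE F := om_tensorE F he hf.
have phi_surj : om_tensor e f @` setT = @moduli_body R m n.
  apply/seteqP; split=> [_ [F _ <-]|c hc].
    by rewrite OTE; exact: om_gram_moduli_body.
  by have [F <-] := moduli_body_om m_gt0 hc; exists F; rewrite ?OTE.
have fullE F : full_in_mn F <->
    interior_in (@Wperp R m n) (@moduli_body R m n) (om_tensor e f F).
  rewrite full_in_mnP moduli_body_interior OTE (addrC 1%:M) subrK unitmx_mul.
  rewrite unitmx_tr andbb.
  by split=> [|[]] //; split=> //; exact: om_gram_moduli_body.
split; first exact: wedge_Wperp_bij.
split.
  apply: (quotient_set_bij 0) phi_surj => F G; rewrite range_equivP !OTE.
  by split=> [->|/addIr].
split; first exact: moduli_body_compact.
split; first exact: moduli_body_convex.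
split.
  apply/seteqP; split=> [c ic|_ [F hF <-]]; last exact/fullE.
  have : moduli_body c by exact: (interior_subset ic).
  by rewrite -phi_surj => -[F _ cE]; exists F => //; apply/fullE; rewrite cE.
split.
  move=> _ [F hF <-]; split; last by move/fullE.
  by apply: subset_closure; rewrite -phi_surj; exists F.
split; first exact: sym_act_moduli_body.
pose orbit c := [set d | moduli_body d /\ @SO_orbit_rel R m n c d].
apply: (quotient_set_bij set0) => [F G|].
  rewrite domain_range_equivP -!OTE; split=> [FG|FG].
    apply/seteqP; split=> d [hd od]; split=> //.
      exact: SO_orbit_rel_trans (SO_orbit_rel_sym FG) od.
    exact: SO_orbit_rel_trans FG od.
  have : orbit (om_tensor e f G) (om_tensor e f G).
    by split; [rewrite -phi_surj; exists G | exact: SO_orbit_relxx].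
  by rewrite /orbit -FG => -[].
rewrite /quotient_set -phi_surj; apply/seteqP.
split=> [_ [F _ <-]|_ [_ [F _ <-] <-]].
  by exists (om_tensor e f F); [exists F | rewrite phi_surj].
by exists F => //; rewrite phi_surj.
Qed.
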